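(* For every integer $n\ge3$ and every $T$ with $0\le T<T_1=\frac1{2^{n-1}-2}$, the algorithm $GR_0$ is optimal and $\gamma^{\mathcal I_{n,T}}=\frac1n$.
   Context: Problem (OPTiWinD on the segment): a vehicle starts at position $0$ at time $0$ and moves in $[-1,1]$ at speed at most $1$. A request is a triple $(A,[r,r+2],\delta)$ with location $A\in[-1,1]$, release time $r\ge0$ and weight $\delta>0$; it is served if the vehicle is at $A$ at some time in $[r,r+2]$. For an integer $n\ge1$ and $T\ge0$, $\mathcal I_{n,T}$ is the set of instances consisting of at most $n$ requests such that the release times of any two successive requests differ by at least $T$. An online algorithm learns each request (location and weight) only at its release time and does not know the number of requests in advance; its movement up to time $t$ depends only on the requests released up to time $t$. For an instance $I$ and algorithm $ALG$, the performance $\lambda^I_{ALG}$ is the total weight of served requests divided by the total weight of all requests; $OPT$ is the optimal offline algorithm. Define $\gamma^{\mathcal I_{n,T}}_{ALG}=\inf_{I\in\mathcal I_{n,T}}\lambda^I_{ALG}/\lambda^I_{OPT}$ (competitive ratio) and $\gamma^{\mathcal I_{n,T}}=\sup_{ALG}\gamma^{\mathcal I_{n,T}}_{ALG}$, the supremum over online algorithms; an online algorithm is optimal if its competitive ratio equals $\gamma^{\mathcal I_{n,T}}$. The algorithm $GR_0$: the vehicle always moves at unit speed towards the request of greatest weight among the released, not yet served requests whose time window is still open (switching destination whenever a new request of greater weight appears). *)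

(* Defs.v *)
From HB Require Import structures.
From mathcomp Require Import all_boot all_order all_algebra.
From mathcomp Require Import all_classical all_reals.

Set Implicit Arguments.
Unset Strict Implicit.
Unset Printing Implicit Defensive.

Import Order.TTheory GRing.Theory Num.Theory.
Local Open Scope classical_set_scope.
Local Open Scope ring_scope.

(* The triple (A, [r, r + 2], delta) is stored as (A, r, delta). *)
Record request (R : realType) := Request {
  loc : R;
  release : R;
  weight : R }.

Definition valid_request (R : realType) (q : request R) : bool :=
  [&& -1 <= loc q, loc q <= 1, 0 <= release q & 0 < weight q].

(* The requests of an instance are listed in order of release; for T = 0
   simultaneous releases are allowed. *)
Definition instance (R : realType) (T : R) (I : seq (request R)) : bool :=
  all (@valid_request R) I &&
  sorted (fun p q => release p + T <= release q) I.

Definition family (R : realType) (n : nat) (T : R) : set (seq (request R)) :=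
  [set I | instance T I /\ (size I <= n)%N].

(* Only the values at times t >= 0 are meaningful; a speed of at most 1 means
   that the position is a 1-Lipschitz function of time. *)
Definition trajectory (R : realType) (x : R -> R) : Prop :=
  [/\ x 0 = 0,
      forall t, 0 <= t -> -1 <= x t <= 1 &
      forall s t, 0 <= s -> s <= t -> `|x t - x s| <= t - s].

Definition served (R : realType) (x : R -> R) (q : request R) : Prop :=
  exists2 t, release q <= t <= release q + 2 & x t = loc q.

Definition performance (R : realType) (I : seq (request R)) (x : R -> R) : R :=
  (\sum_(q <- I | `[< served x q >]) weight q) / \sum_(q <- I) weight q.

(* The supremum is a maximum: an instance has finitely many requests, so the
   performance takes finitely many values. *)
Definition performance_opt (R : realType) (I : seq (request R)) : R :=
  sup [set performance I x | x in @trajectory R].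

Definition algorithm (R : realType) := seq (request R) -> R -> R.

Definition released (R : realType) (t : R) (I : seq (request R)) :
    seq (request R) :=
  [seq q <- I | release q <= t].

Definition online (R : realType) (ALG : algorithm R) : Prop :=
  (forall I, instance 0 I -> trajectory (ALG I)) /\
  (forall I J t, instance 0 I -> instance 0 J -> released t I = released t J ->
     forall s, 0 <= s -> s <= t -> ALG I s = ALG J s).

(* The empty instance is left out, its performance being 0 / 0. *)
Definition competitive_ratio (R : realType) (n : nat) (T : R)
    (ALG : algorithm R) : R :=
  inf [set performance I (ALG I) / performance_opt I |
        I in [set I | family n T I /\ I <> [::]]].

Definition best_ratio (R : realType) (n : nat) (T : R) : R :=
  sup [set competitive_ratio n T ALG | ALG in @online R].

Definition optimal (R : realType) (n : nat) (T : R) (ALG : algorithm R) : Prop :=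
  online ALG /\ competitive_ratio n T ALG = best_ratio n T.

Definition pending (R : realType) (x : R -> R) (t : R) (q : request R) : Prop :=
  release q <= t <= release q + 2 /\
  (forall s, release q <= s -> s <= t -> x s <> loc q).

(* Among requests of equal weight the first in the list is kept: the
   destination changes only for a request of strictly greater weight. *)
Fixpoint heaviest (R : realType) (s : seq (request R)) : option (request R) :=
  if s is q :: s' then
    if heaviest s' is Some p then
      if weight q < weight p then Some p else Some q
    else Some q
  else None.

Definition target (R : realType) (I : seq (request R)) (x : R -> R) (t : R) :
    option (request R) :=
  heaviest [seq q <- I | `[< pending x t q >]].

(* On any time interval with a constant target the vehicle moves towards it at
   unit speed, and it stands still while there is no target. As the target
   changes only finitely often, this determines x on the times t >= 0. *)
Definition greedy (R : realType) (I : seq (request R)) (x : R -> R) : Prop :=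
  forall (s t : R) (o : option (request R)), 0 <= s -> s < t ->
    (forall u, s < u < t -> target I x u = o) ->
    x t = if o is Some q then x s + (t - s) * Num.sg (loc q - x s) else x s.

Definition is_GR0 (R : realType) (ALG : algorithm R) : Prop :=
  forall I, instance 0 I -> trajectory (ALG I) /\ greedy I (ALG I).

(* Main.v *)
(* GR_0 serves a heaviest request: while that request is pending it is the
   destination, and its window is as long as the segment. As no performance
   exceeds 1, the ratio of GR_0 is at least 1/n.

   Against any online algorithm an adversary releases requests of weight 1 at
   the ends -1 and 1 so that the vehicle reaches at most one of n requests,
   while a vehicle zigzagging between the ends at full speed, at the end
   eps * (-1)^i at time 2i + 1, serves all of them. At each stage a single
   request P can still be served, the vehicle is at a distance a > 0 from P,
   and the zigzagging vehicle has left P for the other end, where a new request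
   Q is released. P and Q cannot both be served. The adversary waits until the
   vehicle is within b < a / 2 of an end: the request at the other end is then
   lost, and the next one is released there. With reach m and lead m the minimal
   distance to P and the minimal head start of the zigzagging vehicle (on top of
   a) that leave time for m further releases, spaced by at least T, one finds
   reach (m + 1) = max (2 * reach m) (reach m + T) and
   lead (m + 1) = lead m + 2 * reach m. The game can be started if
   lead (n - 1) = (2^(n - 1) - 2) * T < 1. *)

Require Import Defs.
From HB Require Import structures.
From mathcomp Require Import all_boot all_order all_algebra.
From mathcomp Require Import all_classical all_reals.
From mathcomp Require Import ring lra.

Import Order.TTheory GRing.Theory Num.Theory.
Local Open Scope classical_set_scope.
Local Open Scope ring_scope.

HB.instance Definition _ (R : realType) := gen_eqMixin (request R).

(** * Functions of a real variable *)

Section RealLine.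
Variable R : realType.
Implicit Types (x y f : R -> R) (s t u v c : R).

(** At the infimum of the counterexamples P holds by the third hypothesis; the second one then keeps
    all counterexamples a positive distance away from it. *)
Lemma real_induction (P : R -> Prop) s t :
  P s ->
  (forall v, s <= v -> v < t -> (forall u, s <= u -> u <= v -> P u) ->
    exists2 d, 0 < d & forall u, v < u -> u < v + d -> P u) ->
  (forall v, s < v -> v <= t -> (forall u, s <= u -> u < v -> P u) -> P v) ->
  forall v, s <= v -> v <= t -> P v.
Proof.
move=> Ps Pstep Plim w sw wt; apply: contrapT => nPw.
pose E := [set v | [/\ s <= v, v <= t & ~ P v]].
have E0 : E !=set0 by exists w.
have Elb : lbound E s by move=> v [].
have Ehlb : has_lbound E by exists s.
pose u := inf E.
have su : s <= u by exact: lb_le_inf.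
have uw : u <= w by apply: ge_inf => //; split.
have Plt v : s <= v -> v < u -> P v.
  move=> sv vu; apply: contrapT => nPv.
  have /(ge_inf Ehlb) : E v.
    by split => //; apply: le_trans (ltW vu) _; exact: le_trans uw wt.
  by rewrite leNgt vu.
have Pu : P u.
  have [us|us|->//] := ltgtP u s; first by rewrite leNgt us in su.
  by apply: Plim => //; exact: le_trans uw wt.
have ult : u < t.
  rewrite lt_neqAle (le_trans uw wt) andbT; apply/eqP => ut; apply: nPw.
  by have -> : w = u by apply/eqP; rewrite eq_le uw andbT ut.
have [|d d0 Pd] := Pstep u su ult.
  by move=> v sv; rewrite le_eqVlt => /orP[/eqP->//|]; exact: Plt.
suff : u + d <= u by lra.
apply: lb_le_inf => // v [sv vt nPv]; rewrite leNgt; apply/negP => vd.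
have uv : u <= v by apply: ge_inf => //; split.
apply: nPv; move: uv; rewrite le_eqVlt => /orP[/eqP<-//|uv]; exact: Pd.
Qed.

Lemma first_hitting_time f c s t :
  (forall u v, s <= u -> u <= v -> `|f v - f u| <= v - u) ->
  f s < c -> s <= t -> c <= f t ->
  exists u, [/\ s < u, u <= t, f u = c & forall v, s <= v -> v < u -> f v < c].
Proof.
move=> fL fs st ft.
pose E := [set v | s <= v /\ c <= f v].
have E0 : E !=set0 by exists t.
have Elb : lbound E s by move=> v [].
have Ehlb : has_lbound E by exists s.
pose u := inf E.
have su : s <= u by exact: lb_le_inf.
have ut : u <= t by apply: ge_inf.
have flt v : s <= v -> v < u -> f v < c.
  move=> sv vu; rewrite ltNge; apply/negP => cf.
  have /(ge_inf Ehlb) : E v by [].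
  by rewrite leNgt vu.
have fu1 : c <= f u.
  rewrite leNgt; apply/negP => fuc.
  suff : u + (c - f u) <= u by lra.
  apply: lb_le_inf => // v [sv cv].
  have uv : u <= v by apply: ge_inf.
  by have := fL u v su uv; rewrite ler_norml => /andP[_]; lra.
have su' : s < u.
  by rewrite lt_neqAle su andbT; apply/eqP => E1; move: fu1; rewrite -E1; lra.
have fu2 : f u <= c.
  rewrite leNgt; apply/negP => cfu.
  (* Going back from u by at most the excess [f u - c], the Lipschitz bound keeps f at least c,
     although f is below c before u. *)
  pose v := Num.max s (u - (f u - c)).
  have sv : s <= v by rewrite le_max lexx.
  have vu : v < u by rewrite gt_max su' /=; lra.
  have vu' : u - (f u - c) <= v by rewrite le_max lexx orbT.
  have := fL v u sv (ltW vu); rewrite ler_norml => /andP[_].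
  have := flt v sv vu; lra.
by exists u; split => //; apply/eqP; rewrite eq_le fu1 fu2.
Qed.

Lemma trajectory_eq_lim x y v : trajectory x -> trajectory y -> 0 <= v ->
  (forall s, 0 <= s -> s < v -> x s = y s) -> x v = y v.
Proof.
move=> [x0 _ xL] [y0 _ yL] v0 xy.
have [->|vn0] := eqVneq v 0; first by rewrite x0 y0.
have {vn0 v0} v0 : 0 < v by rewrite lt0r vn0.
apply/eqP; rewrite -subr_eq0 -normr_eq0; apply/negPn/negP => dn0.
have d0 : 0 < `|x v - y v| by rewrite lt0r dn0 normr_ge0.
(* From the common position at s each motion travels at most a quarter of the gap, so the gap at v
   would be at most half of itself. *)
pose s := Num.max 0 (v - `|x v - y v| / 4).
have s0 : 0 <= s by rewrite le_max lexx.
have sv : s < v by rewrite gt_max v0 /=; lra.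
have sv' : v - `|x v - y v| / 4 <= s by rewrite le_max lexx orbT.
have := xL s v s0 (ltW sv); have := yL s v s0 (ltW sv).
rewrite (xy s s0 sv) => h1 h2.
have := ler_normB (x v - y s) (y v - y s).
rewrite (_ : x v - y s - (y v - y s) = x v - y v); last by ring.
lra.
Qed.

End RealLine.

(** * Local characterization and uniqueness of the greedy motion *)

Section Greedy.
Variable R : realType.
Implicit Types (x y : R -> R) (s t u v : R) (q : request R)
  (I J : seq (request R)).

(* An unreleased request is alive. *)
Definition alive x v q : Prop :=
  v < release q + 2 /\ forall s, release q <= s -> s <= v -> x s <> loc q.

Lemma alive_le x u v q : u <= v -> alive x v q -> alive x u q.
Proof.
move=> uv [vq nq]; split; first by lra.
by move=> s qs su; apply: nq => //; lra.
Qed.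

Lemma eq_alive x y v q : 0 <= release q ->
  (forall s, 0 <= s -> s <= v -> x s = y s) -> alive x v q <-> alive y v q.
Proof.
move=> q0 xy; split=> -[vq nq]; split => // s qs sv.
  by rewrite -xy //; [exact: nq|lra].
by rewrite xy //; [exact: nq|lra].
Qed.

(* The target immediately after time v. Unlike [target] it ignores a request
   whose window closes at v, which makes it right-continuous in v. *)
Definition next_target I x v : option (request R) :=
  heaviest [seq q <- I | `[< alive x v q /\ release q <= v >]].

Definition direction (o : option (request R)) (p : R) : R :=
  if o is Some q then Num.sg (loc q - p) else 0.

(** A local form of [greedy], equivalent to it for trajectories when required at all v >= 0. It
    suits real induction, as it supposes nothing about the target on an interval. *)
Definition right_greedy I x v : Prop :=
  exists2 d, 0 < d & forall t, v <= t -> t < v + d ->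
    x t = x v + (t - v) * direction (next_target I x v) (x v).

Lemma heaviest_mem I q : heaviest I = Some q -> q \in I.
Proof.
elim: I q => //= a I IH q; case E : (heaviest I) IH => [p|] IH.
  case: ifP => _ [<-]; last by rewrite mem_head.
  by rewrite inE (IH p) ?orbT.
by move=> [<-]; rewrite mem_head.
Qed.

Lemma le_heaviest I q p : heaviest I = Some q -> p \in I ->
  weight p <= weight q.
Proof.
elim: I q => //= a I IH q; case E : (heaviest I) IH => [r|] IH.
  case: ltP => h [<-]; rewrite inE => /orP[/eqP->//|/(IH _ erefl)//].
    exact: ltW.
  by move/le_trans; apply.
move=> [<-]; rewrite inE => /orP[/eqP->//|].
by case: I E {IH} => //= b I; case: heaviest => // ?; case: ifP.
Qed.

Lemma heaviest_filter (P : pred (request R)) I q : heaviest I = Some q -> P q ->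
  heaviest [seq p <- I | P p] = Some q.
Proof.
elim: I q => //= a I IH q; case E : (heaviest I) IH => [r|] IH.
  case: ltP => h [<-] Pq.
    by case: ifP => _ /=; rewrite (IH r) // h.
  rewrite Pq /=; case F : heaviest => [r'|//].
  have := heaviest_mem _ _ F; rewrite mem_filter => /andP[_ /(le_heaviest _ _ _ E) r'r].
  by rewrite ltNge (le_trans r'r h).
move=> [<-] ->; case: I E {IH} => //= b I; case: heaviest => // ?; by case: ifP.
Qed.

Lemma heaviest_exists I : I <> [::] -> exists q, heaviest I = Some q.
Proof.
by case: I => //= a I _; case: heaviest => [p|]; [case: ifP => _|]; eexists.
Qed.

(** An open window stays open for a while, and a location not yet visited is at positive distance,
    which takes time to cover. Hence no status changes immediately after v. *)
Lemma status_right1 x v q : trajectory x -> 0 <= v ->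
  exists2 d, 0 < d & forall u, v <= u -> u < v + d ->
    [/\ alive x u q <-> alive x v q,
        (u < release q) = (v < release q) &
        v < u -> pending x u q <-> alive x v q /\ release q <= v].
Proof.
move=> [_ _ xL] v0.
have [vq|qv] := ltP v (release q).
  exists (release q - v); first by lra.
  move=> u vu uv; split.
  - by split=> _; split; [lra|move=> s; lra|lra|move=> s; lra].
  - by lra.
  - by move=> _; split=> [[/andP[]]|[]]; lra.
have [av|nav] := pselect (alive x v q).
  have [vq nq] := av.
  have dx : 0 < `|x v - loc q|.
    by rewrite normr_gt0 subr_eq0; apply/eqP; exact: nq.
  exists (Num.min (release q + 2 - v) `|x v - loc q|).
    by rewrite lt_min dx andbT; lra.
  move=> u vu uv.
  have [u1 u2] : u - v < release q + 2 - v /\ u - v < `|x v - loc q|.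
    by apply/andP; rewrite -lt_min; lra.
  have au : alive x u q.
    split; first by lra.
    move=> s qs su; have [sv|vs] := leP s v; first exact: nq.
    move=> xs; have := xL v s v0 (ltW vs); rewrite xs distrC; lra.
  split => //; first by apply/idP/idP; lra.
  move=> _; split=> // _; split; last by case: au.
  by case: au => ? _; apply/andP; split; lra.
exists 1; first by lra.
move=> u vu uv; split.
- by split=> // /(alive_le _ _ _ _ vu).
- by apply/idP/idP; lra.
- move=> vu'; split; last by case.
  move=> [/andP[qu uq] nq]; split => //; split; first by lra.
  by move=> s qs sv; apply: nq => //; lra.
Qed.

Lemma status_right I x v : trajectory x -> 0 <= v ->
  exists2 d, 0 < d & forall q, q \in I -> forall u, v <= u -> u < v + d ->
    [/\ alive x u q <-> alive x v q,
        (u < release q) = (v < release q) &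
        v < u -> pending x u q <-> alive x v q /\ release q <= v].
Proof.
move=> xT v0; elim: I => [|q I [d d0 IH]]; first by exists 1.
have [e e0 He] := status_right1 x v q xT v0.
exists (Num.min d e); first by rewrite lt_min d0.
move=> p; rewrite inE => pI u vu uv.
have [u1 u2] : u - v < d /\ u - v < e by apply/andP; rewrite -lt_min; lra.
by case/orP: pI => [/eqP->|pI]; [apply: He|apply: IH] => //; lra.
Qed.

Lemma target_right I x v : trajectory x -> 0 <= v ->
  exists2 d, 0 < d & forall u, v < u -> u < v + d ->
    target I x u = next_target I x v.
Proof.
move=> xT v0; have [d d0 H] := status_right I x v xT v0.
exists d => // u vu uv; congr heaviest; apply: eq_in_filter => q qI.
by have [_ _ /(_ vu) E] := H q qI u (ltW vu) uv; apply/asboolP/asboolP; rewrite E.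
Qed.

Lemma greedy_right_greedy I x v : trajectory x -> greedy I x -> 0 <= v ->
  right_greedy I x v.
Proof.
move=> xT xG v0; have [d d0 H] := target_right I x v xT v0.
exists d => // t; rewrite le_eqVlt => /orP[/eqP<- _|vt tv].
  by rewrite subrr mul0r addr0.
rewrite (xG v t (next_target I x v) v0 vt).
  by case: next_target => [q|] //=; rewrite mulr0 addr0.
by move=> u /andP[vu ut]; apply: H => //; lra.
Qed.

(** A vehicle that has covered less than its distance to the destination still heads in the same
    direction. *)
Lemma sgr_sub_mul (D h : R) : h < `|D| -> 0 <= h ->
  Num.sg (D - h * Num.sg D) = Num.sg D.
Proof.
move=> hD h0; have [D0|D0|D0] := ltgtP D 0.
- rewrite (ltr0_norm D0) in hD; rewrite (ltr0_sg D0).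
  by apply: ltr0_sg; lra.
- rewrite (gtr0_norm D0) in hD; rewrite (gtr0_sg D0).
  by apply: gtr0_sg; lra.
- by rewrite D0 sgr0 mulr0 subrr sgr0.
Qed.

Lemma right_greedy_greedy I x : trajectory x ->
  (forall v, 0 <= v -> right_greedy I x v) -> greedy I x.
Proof.
move=> xT xG s t o s0 st tgt; have [_ _ xL] := xT.
have next v : s <= v -> v < t -> next_target I x v = o.
  move=> sv vt; have v0 : 0 <= v by lra.
  have [d d0 H] := target_right I x v xT v0.
  pose u := Num.min (v + d / 2) ((v + t) / 2).
  have u1 : u <= v + d / 2 by rewrite ge_min lexx.
  have u2 : u <= (v + t) / 2 by rewrite ge_min lexx orbT.
  have vu : v < u by rewrite lt_min; apply/andP; split; lra.
  rewrite -(H u vu) ?tgt //; last by lra.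
  by apply/andP; split; lra.
suff H : forall v, s <= v -> v <= t ->
    x v = x s + (v - s) * direction o (x s).
  by rewrite (H t (ltW st) (lexx t)); case: (o) => //=; rewrite mulr0 addr0.
apply: real_induction.
- by rewrite subrr mul0r addr0.
- move=> v sv vt H; have v0 : 0 <= v by lra.
  have [d d0 Hd] := xG v v0; exists d => // u vu ud.
  rewrite Hd ?(ltW vu) // next //.
  (* The direction could change only after arrival, but then the vehicle would have visited [loc q]
     by time v and q would not be alive. *)
  have -> : direction o (x v) = direction o (x s).
    case: o next {tgt} H => //= q next H.
    have qI := heaviest_mem _ _ (next s (lexx s) st).
    have qI' := heaviest_mem _ _ (next v sv vt).
    move: qI qI'; rewrite !mem_filter => /andP[/asboolP[_ qs] _].
    move=> /andP[/asboolP[[_ nq] _] _].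
    rewrite (H v sv (lexx v)) opprD addrA; apply: sgr_sub_mul; last by lra.
    rewrite ltNge; apply/negP => hv.
    have n0 := normr_ge0 (loc q - x s).
    apply: (nq (s + `|loc q - x s|)); [by lra|by lra|].
    rewrite H; [|lra|lra].
    by rewrite addrAC subrr add0r mulrC -numEsg; ring.
  by rewrite (H v sv (lexx v)); ring.
- move=> v sv vt H; apply/eqP; rewrite -subr_eq0 -normr_le0 leNgt.
  apply/negP; set a := `|_| => a0.
  have dir1 : `|direction o (x s)| <= 1.
    by case: (o) => [q|] /=; rewrite ?normr0 // normr_sg; case: eqP.
  pose u := Num.max s (v - a / 4).
  have su : s <= u by rewrite le_max lexx.
  have uv : u < v by rewrite gt_max sv /=; lra.
  have uv' : v - a / 4 <= u by rewrite le_max lexx orbT.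
  have u0 : 0 <= u by lra.
  have := xL u v u0 (ltW uv); rewrite (H u su uv) => h1.
  have h2 : `|(v - u) * direction o (x s)| <= v - u.
    by rewrite normrM (gtr0_norm (_ : 0 < v - u)) ?subr_gt0 // ler_piMr //; lra.
  have := ler_normB (x v - (x s + (u - s) * direction o (x s)))
                    ((v - u) * direction o (x s)).
  rewrite (_ : _ - _ - _ = x v - (x s + (v - s) * direction o (x s))); last by ring.
  rewrite -/a; lra.
Qed.

Lemma valid_release I q : all (@valid_request R) I -> q \in I -> 0 <= release q.
Proof. by move=> /allP H /H /and4P[]. Qed.

Lemma eq_next_target I J x y t v :
  all (@valid_request R) I -> all (@valid_request R) J ->
  released t I = released t J -> v <= t ->
  (forall s, 0 <= s -> s <= v -> x s = y s) ->
  next_target I x v = next_target J y v.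
Proof.
move=> vI vJ IJ vt xy.
have E K z : [seq q <- K | `[< alive z v q /\ release q <= v >]] =
    [seq q <- released t K | `[< alive z v q /\ release q <= v >]].
  rewrite /released -filter_predI; apply: eq_filter => q /=.
  apply/idP/andP => [h|[]//]; split => //.
  by move/asboolP : h => -[_]; lra.
rewrite /next_target E (E J) -IJ; congr heaviest; apply: eq_in_filter => q.
rewrite mem_filter => /andP[_ qI].
have [H1 H2] := eq_alive x y v q (valid_release I q vI qI) xy.
by apply/asboolP/asboolP => -[? ?]; split => //; auto.
Qed.

(** As long as the motions agree they have the same next target, hence the same velocity. Two
    instances are allowed because this is also what makes GR_0 online. *)
Lemma greedy_unique I J x y t :
  all (@valid_request R) I -> all (@valid_request R) J ->
  released t I = released t J -> trajectory x -> trajectory y ->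
  greedy I x -> greedy J y -> forall s, 0 <= s -> s <= t -> x s = y s.
Proof.
move=> vI vJ IJ xT yT xG yG; apply: real_induction.
- by case: xT; case: yT => -> _ _ ->.
- move=> v v0 vt xy.
  have [d d0 Hd] := greedy_right_greedy I x v xT xG v0.
  have [e e0 He] := greedy_right_greedy J y v yT yG v0.
  exists (Num.min d e); first by rewrite lt_min d0.
  move=> u vu uv.
  have [u1 u2] : u - v < d /\ u - v < e by apply/andP; rewrite -lt_min; lra.
  rewrite Hd; [|lra|lra]; rewrite He; [|lra|lra].
  by rewrite (eq_next_target I J x y t v) ?(ltW vt) // xy.
- by move=> v v0 vt; apply: trajectory_eq_lim => //; exact: ltW.
Qed.

End Greedy.

(** * Existence of the greedy motion *)

Section GreedyExistence.
Variable R : realType.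
Implicit Types (x y : R -> R) (s t u v : R) (q : request R)
  (I : seq (request R)).

(** These data determine [next_target], which is therefore constant between two changes of
    status. *)
Definition same_status I x s v : Prop := forall q, q \in I ->
  (alive R x v q <-> alive R x s q) /\ (v < release q) = (s < release q).

(* Decreases at each event: a release, an expiry or a service. *)
Definition status_count I x v : nat :=
  (count (fun q => v < release q)%R I + count (fun q => `[< alive R x v q >]) I)%N.

Lemma count_lt (P Q : pred (request R)) I q : subpred P Q -> q \in I ->
  ~~ P q -> Q q -> (count P I < count Q I)%N.
Proof.
move=> PQ; elim: I => //= a I IH; rewrite inE => /orP[/eqP<-|qI] nP Qq.
  by rewrite (negbTE nP) Qq add0n add1n ltnS; exact: sub_count.
rewrite -addnS leq_add ?IH //.
by case: (P a) (PQ a) => // ->.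
Qed.

(** Being unreleased and being alive are both lost for good, so neither count can grow and a change
    lowers one of them. *)
Lemma status_count_lt I x s v : s <= v -> ~ same_status I x s v ->
  (status_count I x v < status_count I x s)%N.
Proof.
move=> sv /existsNP[q /not_implyP[qI /not_andP H]].
have sub1 : subpred (fun q => v < release q) (fun q => s < release q).
  by move=> p /=; exact: le_lt_trans.
have sub2 : subpred (fun q => `[< alive R x v q >]) (fun q => `[< alive R x s q >]).
  by move=> p /= /asboolP h; apply/asboolP; exact: alive_le sv h.
case: H => H.
  rewrite /status_count -addnS leq_add ?sub_count //.
  apply: (count_lt _ _ _ q) => //; last first.
    apply/asboolP; apply: contrapT => h; apply: H.
    by split=> [/(alive_le _ _ _ _ _ sv)|].
  by apply/asboolP => h; apply: H; split=> // _; exact: alive_le sv h.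
rewrite /status_count -addSn leq_add ?sub_count //.
apply: (count_lt _ _ _ q) => //.
  by apply/negP => h; apply: H; rewrite h (sub1 _ h).
by apply/negPn/negP => /negbTE h; apply: H; rewrite h; apply/negP => /sub1; rewrite h.
Qed.

(** Since statuses are constant immediately after any time, the infimum of the times of changed
    status is itself such a time. *)
Lemma status_constant_or_change I x s : trajectory x -> 0 <= s ->
  (forall v, s <= v -> same_status I x s v) \/
  exists t, [/\ s < t, ~ same_status I x s t &
                forall v, s <= v -> v < t -> same_status I x s v].
Proof.
move=> xT s0.
pose E := [set v | s <= v /\ ~ same_status I x s v].
have [E0|E0] := pselect (E !=set0); last first.
  by left=> v sv; apply: contrapT => nv; apply: E0; exists v.
right; have Elb : lbound E s by move=> v [].
have Ehlb : has_lbound E by exists s.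
have before v : s <= v -> v < inf E -> same_status I x s v.
  move=> sv vE; apply: contrapT => nv.
  have /(ge_inf Ehlb) : E v by [].
  by rewrite leNgt vE.
have sE : s <= inf E by exact: lb_le_inf.
have nE : ~ same_status I x s (inf E).
  move=> sm; have [d d0 H] := status_right R I x (inf E) xT (le_trans s0 sE).
  suff : inf E + d <= inf E by lra.
  apply: lb_le_inf => // v [sv nv]; rewrite leNgt; apply/negP => vd.
  have Ev : inf E <= v by apply: ge_inf.
  apply: nv => q qI; have [-> -> _] := H q qI v Ev vd; exact: sm.
exists (inf E); split => //; rewrite lt_neqAle sE andbT.
by apply/eqP => sE'; apply: nE; rewrite -sE' => q.
Qed.

(** Used for the greedy motion between two events and for the legs of the zigzag; D is the
    displacement still to be made, after which the vehicle stops. *)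
Definition redirect x s (D : R) : R -> R := fun t =>
  if t <= s then x t else x s + Num.min (t - s) `|D| * Num.sg D.

Lemma redirect_before x s D t : t <= s -> redirect x s D t = x t.
Proof. by rewrite /redirect => ->. Qed.

Lemma redirect_after x s D t : s <= t ->
  redirect x s D t = x s + Num.min (t - s) `|D| * Num.sg D.
Proof.
rewrite /redirect le_eqVlt => /orP[/eqP<-|st]; last by rewrite leNgt st.
by rewrite lexx subrr min_l ?normr_ge0 // mul0r addr0.
Qed.

Lemma min_sg (h D : R) : 0 <= h ->
  [/\ `|Num.min h `|D| * Num.sg D| <= h,
      Num.min 0 D <= Num.min h `|D| * Num.sg D &
      Num.min h `|D| * Num.sg D <= Num.max 0 D].
Proof.
move=> h0; have [D0|D0|->] := ltgtP D 0.
- rewrite (ltr0_norm D0) (ltr0_sg D0) mulrN1 normrN ger0_norm; last first.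
    by rewrite le_min h0 /=; lra.
  by case: (leP h (- D)) => ?; split; lra.
- rewrite (gtr0_norm D0) (gtr0_sg D0) mulr1 ger0_norm; last first.
    by rewrite le_min h0 ltW.
  by case: (leP h D) => ?; split; lra.
- rewrite sgr0 mulr0 normr0; split=> //; case: leP; lra.
Qed.

Lemma redirect_trajectory x s D : trajectory x -> 0 <= s ->
  -1 <= x s + D <= 1 -> trajectory (redirect x s D).
Proof.
move=> [x0 xb xL] s0 /andP[D1 D2]; split.
- by rewrite redirect_before.
- move=> t t0; have [ts|/ltW st] := leP t s.
    by rewrite redirect_before // xb.
  rewrite redirect_after //.
  have h0 : 0 <= t - s by lra.
  have [_ m1 m2] := min_sg _ D h0.
  have /andP[xs1 xs2] := xb s s0.
  move: m1 m2; set m := _ * _.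
  by case: (leP 0 D) => hD m1 m2; apply/andP; split; lra.
- move=> t u t0 tu.
  have [us|/ltW su] := leP u s.
    by rewrite !redirect_before ?xL // (le_trans tu us).
  have [ts|/ltW st] := leP t s.
    rewrite (redirect_before _ _ _ _ ts) redirect_after //.
    have h0 : 0 <= u - s by lra.
    have [m _ _] := min_sg _ D h0.
    have := xL t s t0 ts => h.
    by rewrite addrAC; apply: (le_trans (ler_normD _ _)); lra.
  rewrite !redirect_after // opprD addrACA subrr add0r -mulrBl normrM.
  have h1 : `|Num.sg D| <= 1 by rewrite normr_sg; case: eqP.
  apply: (@le_trans _ _ `|Num.min (u - s) `|D| - Num.min (t - s) `|D| |).
    by rewrite ler_piMr.
  rewrite ler_norml.
  by case: (leP (u - s) `|D|); case: (leP (t - s) `|D|) => ? ?;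
     apply/andP; split; lra.
Qed.

(** While statuses are constant the target is too, and the vehicle cannot arrive before b, since
    arrival would end the life of the target. *)
Lemma redirect_right_greedy I x s b : trajectory x -> 0 <= s ->
  let D := if next_target R I x s is Some q then loc q - x s else 0 in
  let y := redirect x s D in
  (forall v, s <= v -> v < b -> same_status I y s v) ->
  next_target R I y s = next_target R I x s ->
  forall v, s <= v -> v < b -> right_greedy R I y v.
Proof.
move=> xT s0 D y same next0 v sv vb.
have next : next_target R I y v = next_target R I x s.
  rewrite -next0; congr heaviest; apply: eq_in_filter => q qI.
  have [[H1 H2] H3] := same v sv vb q qI.
  have H4 : (release q <= v) = (release q <= s) by rewrite !leNgt H3.
  by apply/asboolP/asboolP; rewrite H4 => -[/[dup] a _ ?]; split; auto.
have vb2 : v < (v + b) / 2 by lra.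
exists ((b - v) / 2); first by lra.
move=> t vt tb; rewrite next.
have yE w : s <= w -> y w = x s + Num.min (w - s) `|D| * Num.sg D.
  by move=> sw; rewrite /y redirect_after.
have st : s <= t by lra.
rewrite !yE //; case E : (next_target R I x s) => [q|] /=; last first.
  by have -> : D = 0; [rewrite /D E|rewrite sgr0 !mulr0 !addr0].
have DE : D = loc q - x s by rewrite /D E.
have Dlt w : s <= w -> w < b -> w - s < `|D|.
  move=> sw wb; rewrite ltNge; apply/negP => Dw.
  have := heaviest_mem _ _ _ E; rewrite mem_filter => /andP[/asboolP[_ qs] qI].
  have qE : next_target R I y s = Some q by rewrite next0.
  have := heaviest_mem _ _ _ qE; rewrite mem_filter => /andP[/asboolP[yq _] _].
  have [[_ /(_ yq)[_ nq]] _] := same w sw wb q qI.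
  apply: (nq w); [by lra|by lra|].
  by rewrite yE // min_r // mulrC -numEsg DE; ring.
have Dt : t - s < `|D| by apply: Dlt; lra.
have Dv : v - s < `|D| by apply: Dlt; lra.
rewrite (min_l (ltW Dt)) (min_l (ltW Dv)).
rewrite opprD addrA -DE sgr_sub_mul //; last by lra.
by ring.
Qed.

Lemma right_greedy_ext I x y s v : all (@valid_request R) I -> 0 <= v ->
  (forall t, 0 <= t -> t <= s -> x t = y t) -> v < s ->
  right_greedy R I x v -> right_greedy R I y v.
Proof.
move=> vI v0 xy vs [d d0 H].
exists (Num.min d (s - v)); first by rewrite lt_min d0; lra.
move=> t vt tv.
have [t1 t2] : t - v < d /\ t - v < s - v by apply/andP; rewrite -lt_min; lra.
rewrite -!xy; [|lra|lra|lra|lra].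
rewrite (H t vt); last by lra.
rewrite (eq_next_target R I I x y s v) //; first lra.
by move=> u u0 uv; apply: xy => //; lra.
Qed.

(** Induction on [status_count]: the vehicle is sent straight to its target at s, and this motion is
    kept up to the next event, where the count has dropped. *)
Lemma right_greedy_extend I x s : all (@valid_request R) I ->
  0 <= s -> trajectory x ->
  (forall v, 0 <= v -> v < s -> right_greedy R I x v) ->
  exists2 y, trajectory y & forall v, 0 <= v -> right_greedy R I y v.
Proof.
move=> vI; have [k] := ubnP (status_count I x s).
elim: k x s => // k IH x s xk s0 xT xG.
pose D := if next_target R I x s is Some q then loc q - x s else 0.
pose y := redirect x s D.
have xy t : 0 <= t -> t <= s -> x t = y t.
  by move=> _ ts; rewrite /y redirect_before.
have yT : trajectory y.
  apply: redirect_trajectory => //; rewrite /D.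
  case E : next_target => [q|]; last by rewrite addr0; case: xT => _ + _; apply.
  have := heaviest_mem _ _ _ E; rewrite mem_filter => /andP[_ /(allP vI)].
  by rewrite addrC subrK => /and4P[-> ->].
have next0 : next_target R I y s = next_target R I x s.
  by apply: (eq_next_target R I I y x s s) => // t t0 ts; rewrite xy.
have yG v : 0 <= v -> v < s -> right_greedy R I y v.
  by move=> v0 vs; apply: (right_greedy_ext I x y s) => //; exact: xG.
have count_xy : status_count I y s = status_count I x s.
  congr addn; apply: eq_in_count => q qI.
  have [a1 a2] := eq_alive R x y s q (valid_release R I q vI qI) xy.
  by apply/asboolP/asboolP.
have [same|[t [st nt same]]] := status_constant_or_change I y s yT s0.
  exists y => // v v0; have [vs|sv] := ltP v s; first exact: yG.
  apply: (redirect_right_greedy I x s (v + 1)) => //; last by lra.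
  by move=> w sw _; exact: same.
apply: (IH y t) => //.
- by apply: leq_trans (status_count_lt I y s t (ltW st) nt) _; rewrite count_xy.
- by lra.
- move=> v v0 vt; have [vs|sv] := ltP v s; first exact: yG.
  exact: (redirect_right_greedy I x s t).
Qed.

Lemma greedy_exists I : all (@valid_request R) I ->
  exists2 x, trajectory x & greedy I x.
Proof.
move=> vI; have T0 : trajectory (fun _ : R => 0 : R).
  by split=> // [t _|s t _ st]; [lra|rewrite subrr normr0; lra].
have [|x xT xG] := right_greedy_extend I _ 0 vI (lexx 0) T0; first by move=> v; lra.
by exists x => //; exact: right_greedy_greedy.
Qed.

Lemma GR0_exists : exists GR0 : algorithm R, is_GR0 GR0.
Proof.
have /choice[f Hf] : forall I, exists x : R -> R,
    instance 0 I -> trajectory x /\ greedy I x.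
  move=> I; have [/andP[vI _]|nI] := boolP (instance 0 I).
    by have [x xT xG] := greedy_exists I vI; exists x.
  by exists id.
by exists f => I; exact: Hf.
Qed.

Lemma GR0_online (GR0 : algorithm R) : is_GR0 GR0 -> online GR0.
Proof.
move=> G; split=> [I /G[]//|I J t iI iJ IJ].
have [[xT xG] [yT yG]] := (G I iI, G J iJ).
by move: iI iJ => /andP[vI _] /andP[vJ _]; exact: (greedy_unique R I J).
Qed.

Lemma greedy_serves_heaviest I x q : all (@valid_request R) I ->
  trajectory x -> greedy I x -> heaviest I = Some q -> served x q.
Proof.
move=> vI xT xG Iq; apply: contrapT => nq.
have /and4P[q1 q2 r0 _] : valid_request q.
  by apply: (allP vI); exact: heaviest_mem Iq.
have pend u : release q <= u -> u <= release q + 2 -> pending x u q.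
  move=> ru ur; split; first by apply/andP.
  by move=> s rs su xs; apply: nq; exists s => //; apply/andP; split; lra.
have tgt u : release q < u -> u < release q + 2 -> target I x u = Some q.
  by move=> ru ur; apply: heaviest_filter => //; apply/asboolP/pend; lra.
have [_ xb _] := xT; have /andP[b1 b2] := xb _ r0.
pose D := loc q - x (release q).
have D2 : `|D| <= 2 by rewrite ler_norml /D; apply/andP; split; lra.
have [D0|D0] := eqVneq D 0.
  apply: nq; exists (release q); first by apply/andP; split; lra.
  by move: D0; rewrite /D; lra.
have {}D0 : 0 < `|D| by rewrite normr_gt0.
(* Never served, q would be pending throughout its window and hence the target, so the vehicle would
   arrive after time [|D|], at most 2. *)
apply: nq; exists (release q + `|D|); first by apply/andP; split; lra.
rewrite (xG (release q) _ (Some q)) //; [|lra|].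
  by rewrite addrAC subrr add0r mulrC -numEsg /D; ring.
by move=> u /andP[ru ur]; apply: tgt; lra.
Qed.

End GreedyExistence.

(** * Performances *)

Section Ratios.
Variable R : realType.
Implicit Types (x y z : R -> R) (s t u v T : R) (q : request R)
  (I J : seq (request R)) (n : nat).

Definition served_weight I x : R := \sum_(q <- I | `[< served x q >]) weight q.

Lemma instance_weaken T I : 0 <= T -> instance T I -> instance 0 I.
Proof.
move=> T0 /andP[vI sI]; rewrite /instance vI /=.
by apply: sub_sorted sI => p q /=; lra.
Qed.

Lemma weight_gt0 I q : all (@valid_request R) I -> q \in I -> 0 < weight q.
Proof. by move=> /allP H /H /and4P[]. Qed.

Lemma total_gt0 I : all (@valid_request R) I -> I <> [::] ->
  0 < \sum_(q <- I) weight q.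
Proof.
case: I => // q I vI _; rewrite big_cons ltr_pwDl //.
  by apply: (weight_gt0 _ _ vI); rewrite mem_head.
by rewrite big_seq sumr_ge0 // => p pI; apply/ltW/(weight_gt0 _ _ vI); rewrite inE pI orbT.
Qed.

Lemma served_weight_ge0 I x : all (@valid_request R) I -> 0 <= served_weight I x.
Proof.
move=> vI; rewrite /served_weight big_seq_cond sumr_ge0 // => q /andP[qI _].
exact/ltW/(weight_gt0 _ _ vI).
Qed.

Lemma served_weight_le I x : all (@valid_request R) I ->
  served_weight I x <= \sum_(q <- I) weight q.
Proof.
move=> vI; rewrite /served_weight big_mkcond /= big_seq [leRHS]big_seq.
apply: ler_sum => q qI; case: ifP => // _; exact/ltW/(weight_gt0 _ _ vI).
Qed.

Lemma served_weight_ge I x q : all (@valid_request R) I -> q \in I ->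
  served x q -> weight q <= served_weight I x.
Proof.
move=> vI qI /asboolP qs.
rewrite /served_weight -big_filter (perm_big _ (perm_to_rem (_ : q \in _))) /=.
  rewrite big_cons lerDl big_seq sumr_ge0 // => p /mem_rem.
  by rewrite mem_filter => /andP[_ pI]; exact/ltW/(weight_gt0 _ _ vI).
by rewrite mem_filter qs.
Qed.

Lemma performance_ge0 I x : all (@valid_request R) I -> 0 <= performance I x.
Proof.
move=> vI; rewrite /performance divr_ge0 //; first exact: served_weight_ge0.
by rewrite big_seq sumr_ge0 // => q /(weight_gt0 _ _ vI)/ltW.
Qed.

Lemma performance_le1 I x : all (@valid_request R) I -> I <> [::] ->
  performance I x <= 1.
Proof.
move=> vI I0; rewrite /performance ler_pdivrMr ?total_gt0 // mul1r.
exact: served_weight_le.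
Qed.

Lemma performance_le_opt I x : all (@valid_request R) I -> I <> [::] ->
  trajectory x -> performance I x <= performance_opt I.
Proof.
move=> vI I0 xT; apply: sup_upper_bound; last by exists x.
split; first by exists (performance I x), x.
by exists 1 => _ [y _ <-]; exact: performance_le1.
Qed.

Lemma performance_opt_le1 I x : all (@valid_request R) I -> I <> [::] ->
  trajectory x -> performance_opt I <= 1.
Proof.
move=> vI I0 xT; apply: ge_sup; first by exists (performance I x), x.
by move=> _ [y _ <-]; exact: performance_le1.
Qed.

Lemma ratio_ge0 I x : all (@valid_request R) I -> I <> [::] ->
  trajectory x -> 0 <= performance I x / performance_opt I.
Proof.
move=> vI I0 xT; have h := performance_ge0 I x vI.
by rewrite divr_ge0 // (le_trans h) // performance_le_opt.
Qed.

Lemma greedy_ratio n I x : all (@valid_request R) I -> I <> [::] ->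
  (size I <= n)%N -> trajectory x -> greedy I x ->
  1 / n%:R <= performance I x / performance_opt I.
Proof.
move=> vI I0 In xT xG.
have [q Iq] := heaviest_exists _ _ I0.
have qI := heaviest_mem _ _ _ Iq.
have q0 := weight_gt0 _ _ vI qI.
have n0 : 0 < n%:R :> R.
  by rewrite ltr0n (leq_trans _ In) // lt0n size_eq0; apply/eqP.
have t0 := total_gt0 _ vI I0.
have perf : 1 / n%:R <= performance I x.
  rewrite /performance ler_pdivlMr // mul1r mulrC ler_pdivrMr //.
  have le1 : \sum_(p <- I) weight p <= n%:R * weight q.
    apply: (@le_trans _ _ (\sum_(p <- I) weight q)).
      by rewrite big_seq [leRHS]big_seq ler_sum // => p; exact: le_heaviest.
    rewrite big_const_seq count_predT iter_addr_0 -[leLHS]mulr_natl.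
    by rewrite ler_wpM2r ?ler_nat // ltW.
  apply: (le_trans le1); rewrite mulrC ler_pM2r //.
  apply: (served_weight_ge _ _ _ vI qI).
  exact: (greedy_serves_heaviest _ _ _ _ vI xT xG Iq).
have p0 : 0 < performance I x by apply: lt_le_trans perf; rewrite divr_gt0.
have o0 := performance_le_opt _ _ vI I0 xT.
(* The optimum is positive and at most 1, so dividing by it does not lower the bound on the
   performance. *)
rewrite ler_pdivlMr; last exact: lt_le_trans o0.
apply: le_trans perf; rewrite ler_piMr ?divr_ge0 //.
exact: performance_opt_le1 xT.
Qed.

End Ratios.

(** * The adversary *)

Section Zigzag.
Variable R : realType.
Implicit Types (x y z : R -> R) (s t u v p a e : R) (q : request R)
  (I J : seq (request R)) (n m i j : nat).

(** Induction on the number of legs: at the end reached at time 2N + 1 the vehicle turns, and it is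
    at the other end exactly 2 later. *)
Lemma zigzag (eps : R) N : eps = 1 \/ eps = -1 ->
  exists2 z, trajectory z & forall i, (i <= N)%N ->
    z (2 * i%:R + 1) = eps * (-1) ^+ i.
Proof.
move=> he.
have sgn i : eps * (-1) ^+ i = 1 \/ eps * (-1) ^+ i = -1.
  by rewrite -signr_odd; case: odd; case: he => ->; rewrite /= ?expr0 ?expr1 ?mulr1 ?mulrN1 ?opprK; auto.
elim: N => [|N [z zT Hz]].
  exists (redirect R (fun=> 0) 0 eps).
    apply: redirect_trajectory => //; last by case: he => ->; apply/andP; split; lra.
    by split=> // [t _|s t _ st] /=; [lra|rewrite subrr normr0; lra].
  move=> i; rewrite leqn0 => /eqP->; rewrite redirect_after; last by lra.
  by case: he => ->; rewrite ?normrN normr1 min_r ?sgrN ?sgr1 ?expr0; lra.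
pose w : R := 2 * N%:R + 1; pose e := eps * (-1) ^+ N.
have zw : z w = e by apply: Hz.
exists (redirect R z w (- (2 * e))).
  apply: redirect_trajectory => //; first by rewrite /w addr_ge0 // mulr_ge0.
  by rewrite zw /e; case: (sgn N) => ->; lra.
move=> i; rewrite leq_eqVlt => /orP[/eqP->|].
  rewrite redirect_after; last by rewrite /w -natr1; lra.
  have -> : eps * (-1) ^+ N.+1 = - e by rewrite exprS /e; ring.
  rewrite zw (_ : _ - w = 2); last by rewrite /w -natr1; ring.
  rewrite min_r; first by rewrite [_ * Num.sg _]mulrC -numEsg; ring.
  by rewrite ler_norml /e; case: (sgn N) => ->; lra.
rewrite ltnS => iN; rewrite redirect_before ?Hz //.
by rewrite /w lerD2r ler_wpM2l // ler_nat.
Qed.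

End Zigzag.

(** * The game against a fixed online algorithm *)

Section Game.
Variables (R : realType) (T eps : R) (ALG : algorithm R).
Hypotheses (T0 : 0 <= T) (eps1 : eps = 1 \/ eps = -1) (onl : online ALG).
Implicit Types (x y z : R -> R) (s t u v p a e : R) (q : request R)
  (I J : seq (request R)) (n m i j : nat).

(** The bound j is there because [zigzag] provides finitely many legs only. *)
Definition zigzag_serves j I : Prop := forall q, q \in I ->
  exists2 i, (i <= j)%N & loc q = eps * (-1) ^+ i /\
    release q <= 2 * i%:R + 1 <= release q + 2.

(** The first alternative is an early end of the game: an algorithm that serves nothing has ratio 0
    whatever the number of requests. Otherwise all n of them are needed for 1/n. *)
Definition hard n J : Prop :=
  [/\ instance T J /\ (size J <= n)%N, J <> [::],
      forall q, q \in J -> weight q = 1,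
      exists j, zigzag_serves j J &
      served_weight R J (ALG J) <= 0 \/
      size J = n /\ served_weight R J (ALG J) <= 1].

(** Solution of the recursion with [max] started at 0: its second term gives the value T at 1, and
    from there on doubling is at least as large. *)
Fixpoint reach m : R := if m is m'.+1 then 2 ^+ m' * T else 0.

Fixpoint lead m : R := if m is m'.+1 then lead m' + 2 * reach m' else 0.

Lemma reachS m : 2 * reach m <= reach m.+1 /\ reach m + T <= reach m.+1.
Proof.
case: m => [|m] /=; first by rewrite expr0 mulr0 mul1r add0r.
rewrite exprS; have p0 : 1 <= 2 ^+ m :> R by apply: exprn_ege1; lra.
by have := ler_wpM2r T0 p0; split; lra.
Qed.

Lemma leadE m : lead m.+1 = (2 ^+ m.+1 - 2) * T.
Proof.
elim: m => [|m IH]; first by rewrite /= expr1; ring.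
by rewrite -[LHS]/(lead m.+1 + 2 * (2 ^+ m * T)) IH !exprS; ring.
Qed.

Lemma reach_ge0 m : 0 <= reach m.
Proof. by case: m => //= m; rewrite mulr_ge0 // exprn_ge0. Qed.

Definition active p e : request R := Request e p 1.

Lemma instance_rcons I q : instance T I -> valid_request q ->
  (forall q', q' \in I -> release q' + T <= release q) -> instance T (rcons I q).
Proof.
move=> /andP[vI sI] vq Iq; rewrite /instance all_rcons vq vI /=.
case: I sI Iq {vI} => //= b I sI Iq; rewrite rcons_path sI /=.
by apply: Iq; exact: mem_last.
Qed.

(** Before s the request q is unknown to the algorithm, and by continuity its release does not
    affect the position at s either. So the adversary may choose q from that position. *)
Lemma alg_rcons I s q t : instance 0 I -> instance 0 (rcons I q) ->
  release q = s -> 0 <= t -> t <= s -> ALG (rcons I q) t = ALG I t.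
Proof.
move=> iI iJ qs; have agree v : 0 <= v -> v < s -> ALG (rcons I q) v = ALG I v.
  move=> v0 vs; apply: (onl.2 _ _ v) => //.
  by rewrite /released filter_rcons qs leNgt vs.
move=> t0; rewrite le_eqVlt => /orP[/eqP ts|]; last exact: agree.
apply: (trajectory_eq_lim R) => //; [exact: onl.1|exact: onl.1|].
by rewrite ts; exact: agree.
Qed.

Lemma served_weight_rcons I q x : weight q = 1 ->
  served_weight R (rcons I q) x = served_weight R I x + (`[< served x q >])%:R.
Proof.
move=> q1; rewrite /served_weight -cats1 big_cat /= big_cons big_nil q1.
by case: asboolP; rewrite ?addr0.
Qed.

(** At time u the vehicle is at distance 2 - b from e, more than the time p + 2 - u left in the
    window. *)
Lemma far_not_served x u p d b e : trajectory x -> 0 <= u -> 0 <= p ->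
  e = 1 \/ e = -1 -> x u = - e * (1 - b) -> b < u - p -> b < 2 ->
  (forall t, p <= t -> t <= u -> x t <> e) -> ~ served x (Request e p d).
Proof.
move=> [_ _ xL] u0 p0 he xu bu b2 nv [t /= /andP[pt tp] xt].
have [tu|/ltW ut] := leP t u; first exact: (nv t).
have := xL u t u0 ut; rewrite xt xu ler_norml => /andP[].
by case: he => ->; lra.
Qed.

Lemma eq_sgr_cases e (c d : R) : e = 1 \/ e = -1 -> `|c| = d ->
  c = e * d \/ c = - e * d.
Proof.
move=> he; case: (leP 0 c) => c0 <-; [rewrite ger0_norm //|rewrite ltr0_norm //];
  by case: he => ->; rewrite ?opprK ?mulNr ?mul1r ?opprK; auto.
Qed.

(* [active p e] is the request P of the introduction, [2 * j + 1] the time at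
   which the zigzag leaves its location e, s the time of the next release. The
   bound on [served_weight] says that whatever the vehicle does after s, it
   serves nothing but P. *)
Lemma adversary_step m I j e a s p :
  e = eps * (-1) ^+ j ->
  instance T I -> (forall q, q \in I -> weight q = 1) ->
  zigzag_serves j.+1 I -> (forall q, q \in I -> release q + T <= s) ->
  0 <= p -> p <= 2 * j%:R + 1 -> s <= 2 * j%:R + 3 ->
  ALG I s = e * (1 - a) -> a < 1 ->
  (forall t, p <= t -> t <= s -> ALG I t <> e) ->
  (forall y, trajectory y -> (forall t, 0 <= t -> t <= s -> y t = ALG I t) ->
    served_weight R I y <= (`[< served y (active p e) >])%:R) ->
  reach m < a -> a + lead m < s - (2 * j%:R + 1) ->
  exists J, hard (size I + m.+1) J.
Proof.
have [k] := ubnP m; elim: k m I j e a s p => // k IH m I j e a s p mk.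
move=> eE iI wI zI relI p0 pw sw xs a1 nv swI ha hl.
have j0 : 0 <= j%:R :> R by [].
have a0 : 0 < a by apply: le_lt_trans ha; exact: reach_ge0.
have he : e = 1 \/ e = -1.
  rewrite eE -signr_odd; case: odd; case: eps1 => ->;
    rewrite /= ?expr0 ?expr1 ?mulr1 ?mulrN1 ?opprK; auto.
have l0 : 0 <= lead m.
  by elim: (m) => //= m' h; rewrite addr_ge0 // mulr_ge0 // reach_ge0.
have ws : 2 * j%:R + 1 < s by lra.
have s0 : 0 <= s by lra.
pose q := active s (- e); pose J := rcons I q.
have vq : valid_request q.
  by apply/and4P; rewrite /= s0; case: he => ->; split => //; lra.
have iJ : instance T J by exact: instance_rcons.
have iJ0 := instance_weaken R T J T0 iJ.
have iI0 := instance_weaken R T I T0 iI.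
have JT : trajectory (ALG J) by exact: onl.1.
have [_ _ JL] := JT.
have JI t : 0 <= t -> t <= s -> ALG J t = ALG I t by exact: alg_rcons.
have wJ r : r \in J -> weight r = 1.
  by rewrite mem_rcons inE => /orP[/eqP->|/wI].
have zJ : zigzag_serves j.+1 J.
  move=> r; rewrite mem_rcons inE => /orP[/eqP->|/zI//].
  (* The zigzag is at -e at time 2j + 3, which lies in the window of Q because 2j + 1 < s <= 2j +
     3. *)
  exists j.+1 => //; rewrite /= exprS mulrCA -eE mulN1r -natr1.
  by split => //; apply/andP; split; lra.
have sJ : size J = (size I).+1 by rewrite size_rcons.
have J0 : J <> [::] by move=> J0; rewrite J0 in sJ.
have Js : ALG J s = e * (1 - a) by rewrite JI.
have swJ y : trajectory y -> (forall t, 0 <= t -> t <= s -> y t = ALG J t) ->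
    served_weight R J y <= (`[< served y (active p e) >])%:R + (`[< served y q >])%:R.
  move=> yT yJ; rewrite served_weight_rcons // lerD2r; apply: swI => // t t0 ts.
  by rewrite yJ // JI.
have hardJ0 : served_weight R J (ALG J) <= 0 -> exists J, hard (size I + m.+1) J.
  move=> h; exists J; split => //; first by rewrite sJ addnS ltnS leq_addr.
    by exists j.+1.
  by left.
have JsN : ALG J s <> - e by rewrite Js; case: he => ->; lra.
have nvJ t : p <= t -> t <= s -> ALG J t <> e.
  by move=> pt ts; rewrite JI //; [exact: nv|lra].
(* If with no further release neither P nor Q gets served, the game ends with nothing served.
   Otherwise the vehicle reaches an end after s. *)
have [nPQ|PQ] := pselect (~ served (ALG J) (active p e) /\ ~ served (ALG J) q).
  apply: hardJ0; apply: le_trans (swJ _ JT _) _ => //.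
  by case: nPQ => /asboolPn/negbTE-> /asboolPn/negbTE->; rewrite addr0.
have [t [st Jt]] : exists t, s < t /\ `|ALG J t| = 1.
  have norm1 : `|e| = 1 /\ `|- e| = 1.
    by rewrite normrN; case: he => ->; rewrite ?normrN normr1.
  move/not_andP : PQ => [] /contrapT[t /= /andP[t1 t2] Jt].
    exists t; rewrite Jt norm1.1; split => //; rewrite ltNge; apply/negP => ts.
    exact: (nvJ t).
  exists t; rewrite Jt norm1.2; split => //; rewrite lt_neqAle t1 andbT.
  by apply/eqP => st; apply: JsN; rewrite st.
case: m mk ha hl l0 hardJ0 => [|m] mk ha hl l0 hardJ0.
  exists J; split => //; first by rewrite sJ addn1.
    by exists j.+1.
  right; split; first by rewrite sJ addn1.
  apply: le_trans (swJ _ JT _) _ => //.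
  case: asboolP => [[t1 /= /andP[t11 t12] J1]|_]; last first.
    by rewrite add0r lern1 leq_b1.
  case: asboolP => [[t2 /= /andP[t21 t22] J2]|_]; last first.
    by rewrite addr0.
  have st1 : s <= t1.
    by rewrite leNgt; apply/negP => ts; apply: (nvJ t1) => //; exact: ltW.
  have := JL s t1 s0 st1; have := JL s t2 s0 t21; rewrite Js J1 J2 !ler_norml.
  (* P first: Q is reached at s + a + 2 at the earliest, too late for Q. Q first: the vehicle is
     back at P at s + 4 - a at the earliest, while P closes at p + 2 < s + 2. *)
  have [t12'|/ltW t21'] := leP t1 t2.
    have t10 : 0 <= t1 by lra.
    have := JL t1 t2 t10 t12'; rewrite J1 J2 ler_norml.
    by case: he => -> /andP[? ?] /andP[? ?] /andP[? ?]; lra.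
  have t20 : 0 <= t2 by lra.
  have := JL t2 t1 t20 t21'; rewrite J1 J2 ler_norml.
  by case: he => -> /andP[? ?] /andP[? ?] /andP[? ?]; lra.
have [r1 r2] := reachS m.
(* The bounds on b: below [a / 2], Q is lost if the vehicle comes near P; below [a - T], the next
   release is at least T later; the last one leaves the lead b + [lead m] if the vehicle goes to Q
   instead. *)
pose M := Num.min (a / 2) (Num.min (a - T) ((s - (2 * j%:R + 1) - a - lead m) / 2)).
have mM : reach m < M.
  by rewrite !lt_min; move: hl ha r1 r2 => /= *; apply/and3P; split; lra.
have [M1 M2 M3] : [/\ M <= a / 2, M <= a - T &
    M <= (s - (2 * j%:R + 1) - a - lead m) / 2].
  by split; rewrite !ge_min lexx ?orbT.
pose b := (reach m + M) / 2.
have [bm bM] : reach m < b /\ b < M by rewrite /b; split; lra.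
have b0 : 0 < b by apply: le_lt_trans bm; exact: reach_ge0.
have [u [su ut Ju before]] : exists u, [/\ s < u, u <= t, `|ALG J u| = 1 - b &
    forall v, s <= v -> v < u -> `|ALG J v| < 1 - b].
  apply: (first_hitting_time R (fun v => `|ALG J v|)) => //.
  - move=> v w sv vw; apply: le_trans (ler_dist_dist _ _) _.
    by apply: JL => //; lra.
  - by rewrite Js ltr_norml; case: he => ->; apply/andP; split; lra.
  - exact: ltW.
  - by rewrite Jt; lra.
have away v : s <= v -> v <= u -> ALG J v <> e /\ ALG J v <> - e.
  move=> sv; rewrite le_eqVlt => /orP[/eqP vu|vu].
    by rewrite vu; split=> ue; move: Ju; rewrite ue;
       case: he => ->; rewrite ?opprK ?normrN normr1; lra.
  by split=> ve; have := before v sv vu; rewrite ve;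
     case: he => ->; rewrite ?opprK ?normrN normr1; lra.
have u0 : 0 <= u by lra.
have nvP v : p <= v -> v <= u -> ALG J v <> e.
  move=> pv vu; have [vs|/ltW sv] := leP v s; first exact: nvJ.
  by have [] := away v sv vu.
have nvQ v : s <= v -> v <= u -> ALG J v <> - e.
  by move=> sv vu; have [] := away v sv vu.
have relJ r : r \in J -> s + T <= u -> release r + T <= u.
  move=> rJ suT; move: rJ; rewrite mem_rcons inE => /orP[/eqP->//|/relI].
  by lra.
have -> : (size I + m.+2 = size J + m.+1)%N by rewrite sJ addSnnS.
(* Vehicle near e: Q is lost, and the game goes on with P and the same j. *)
have [Jue|Jue] := eq_sgr_cases _ _ _ he Ju.
  have e1 : a - b <= u - s.
    have := JL s u s0 (ltW su); rewrite Js Jue ler_norml.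
    by case: he => -> /andP[? ?]; lra.
  have nQ y : trajectory y -> (forall t, 0 <= t -> t <= u -> y t = ALG J t) ->
      ~ served y q.
    move=> yT yJ; apply: (far_not_served y u s 1 b) => //.
    - by case: he => ->; rewrite ?opprK; auto.
    - by rewrite yJ // Jue opprK.
    - by lra.
    - by lra.
    - by move=> v sv vu; rewrite yJ //; [exact: nvQ|lra].
  apply: (IH m J j e b u p) => //.
  - by move=> r rJ; apply: relJ => //; lra.
  (* As Q is lost, the vehicle serves P under J, and not before u; hence u <= p + 2 <= 2j + 3. *)
  - move/not_andP : PQ => [/contrapT|/contrapT/nQ]; last by case.
    move=> [v /= /andP[v1 v2] Jv]; apply: (@le_trans _ _ v); last by lra.
    rewrite leNgt; apply/negP => vu; exact: (nvP v v1 (ltW vu)).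
  - by lra.
  - move=> y yT yJ; apply: le_trans (swJ y yT _) _.
      by move=> v v0 vs; apply: yJ => //; lra.
    by have /asboolPn/negbTE-> := nQ y yT yJ; rewrite addr0.
  - by move: hl => /=; lra.
(* Vehicle near -e: P is lost, Q takes its place, and the ends are exchanged with j + 1 for j. *)
have e1 : 2 - a - b <= u - s.
  have := JL s u s0 (ltW su); rewrite Js Jue ler_norml.
  by case: he => -> /andP[? ?]; lra.
have nP y : trajectory y -> (forall t, 0 <= t -> t <= u -> y t = ALG J t) ->
    ~ served y (active p e).
  move=> yT yJ; apply: (far_not_served y u p 1 b) => //.
  - by rewrite yJ.
  - by lra.
  - by lra.
  - by move=> v pv vu; rewrite yJ //; [exact: nvP|lra].
apply: (IH m J j.+1 (- e) b u s) => //.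
- by rewrite exprS mulrCA -eE mulN1r.
- by move=> r rJ; have [i ij H] := zJ r rJ; exists i => //; exact: leqW.
- by move=> r rJ; apply: relJ => //; lra.
- by rewrite -natr1; lra.
- move/not_andP : PQ => [/contrapT/nP|/contrapT]; first by case.
  move=> [v /= /andP[v1 v2] Jv]; apply: (@le_trans _ _ v); last by rewrite -natr1; lra.
  rewrite leNgt; apply/negP => vu; exact: (nvQ v v1 (ltW vu)).
- by lra.
- move=> y yT yJ; apply: le_trans (swJ y yT _) _.
    by move=> v v0 vs; apply: yJ => //; lra.
  by have /asboolPn/negbTE-> := nP y yT yJ; rewrite add0r.
- by move: hl => /=; rewrite -natr1; lra.
Qed.

(** The first request is released at time 1 at the end eps, which the zigzag leaves at once, while
    the vehicle is at distance at least 1 from it. *)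
Lemma adversary_start m : 2 * reach m + lead m < 1 -> T <= reach m ->
  eps * ALG [::] 1 <= 0 -> exists J, hard m.+2 J.
Proof.
move=> hm hT x1.
(* The next release waits until the vehicle is within a of the request, for a time of at least 1 -
   a. The midpoint gives both [reach m < a] and a + [lead m] < 1 - a. *)
pose a := (reach m + (1 - lead m) / 2) / 2.
have [ha la] : reach m < a /\ 2 * a + lead m < 1 by rewrite /a; split; lra.
have l0 : 0 <= lead m.
  by elim: (m) => //= m' h; rewrite addr_ge0 // mulr_ge0 // reach_ge0.
have r0 := reach_ge0 m.
pose q := active 1 eps; pose I := [:: q].
have vq : valid_request q.
  by apply/and4P; rewrite /=; case: eps1 => ->; split => //; lra.
have iI : instance T I by rewrite /instance /= vq.
have iI0 : instance 0 I by rewrite /instance /= vq.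
have IT : trajectory (ALG I) by exact: onl.1.
have [_ _ IL] := IT.
have I1 : ALG I 1 = ALG [::] 1 by apply: (alg_rcons [::] 1 q).
have wI r : r \in I -> weight r = 1 by rewrite inE => /eqP->.
have zI j : zigzag_serves j I.
  move=> r; rewrite inE => /eqP->; exists 0%N => //=.
  by rewrite expr0 mulr1; split => //; apply/andP; split; lra.
have swI y : served_weight R I y = (`[< served y q >])%:R.
  by rewrite /served_weight big_cons big_nil /=; case: asboolP; rewrite ?addr0.
have [qs|nqs] := pselect (served (ALG I) q); last first.
  exists I; split => //; first by exists 0%N.
  by left; rewrite swI; move/asboolPn/negbTE : nqs => ->.
have [t /= /andP[t1 t2] It] := qs.
have [u [u1 ut Iu before]] : exists u, [/\ 1 < u, u <= t, eps * ALG I u = 1 - a &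
    forall v, 1 <= v -> v < u -> eps * ALG I v < 1 - a].
  apply: (first_hitting_time R (fun v => eps * ALG I v)) => //.
  - move=> v w sv vw; rewrite -mulrBr normrM.
    have -> : `|eps| = 1 by case: eps1 => ->; rewrite ?normrN normr1.
    by rewrite mul1r; apply: IL => //; lra.
  - by rewrite I1; lra.
  - by rewrite It; case: eps1 => ->; lra.
have Iu' : ALG I u = eps * (1 - a).
  by move: Iu; case: eps1 => ->; lra.
have ua : 1 - a <= u - 1.
  have := IL 1 u ler01 (ltW u1); rewrite ler_norml Iu'; move: x1; rewrite -I1.
  by case: eps1 => -> ? /andP[? ?]; lra.
have -> : m.+2 = (size I + m.+1)%N by [].
apply: (adversary_step m I 0 eps a u 1) => //.
- by rewrite expr0 mulr1.
- by move=> r; rewrite inE => /eqP->/=; lra.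
- by lra.
- by lra.
- by lra.
- move=> v v1; rewrite le_eqVlt => /orP[/eqP->|vu] Iv.
    by move: Iu; rewrite Iv; case: eps1 => ->; lra.
  by have := before v v1 vu; rewrite Iv; case: eps1 => ->; lra.
- by move=> y _ _; rewrite swI.
- by lra.
Qed.

End Game.

(** * From the game to the competitive ratio *)

Lemma hard_ratio (R : realType) (T eps : R) (ALG : algorithm R) n J :
  eps = 1 \/ eps = -1 -> (0 < n)%N -> hard R T eps ALG n J ->
  performance J (ALG J) / performance_opt J <= 1 / n%:R.
Proof.
move=> he n0 [[/andP[vJ _] sJ] J0 wJ [j zJ] swJ].
(* The zigzag serves all of J, so the optimum is 1 and the ratio is the performance of the
   algorithm. *)
have [z zT Hz] := zigzag R eps j he.
have zs q : q \in J -> served z q.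
  move=> qJ; have [i ij [ql qr]] := zJ q qJ.
  by exists (2 * i%:R + 1) => //; rewrite Hz.
have tot : \sum_(q <- J) weight q = (size J)%:R.
  rewrite big_seq (eq_bigr (fun=> 1)) => [|q /wJ//].
  by rewrite -big_seq big_const_seq count_predT iter_addr_0.
have Jz : performance J z = 1.
  have -> : performance J z = (\sum_(q <- J) weight q) / \sum_(q <- J) weight q.
    congr (_ / _); rewrite [LHS]big_mkcond [LHS]big_seq [RHS]big_seq /=.
    by apply: eq_bigr => q /zs/asboolP->.
  by rewrite divff // gt_eqF // total_gt0.
have opt : performance_opt J = 1.
  apply/eqP; rewrite eq_le (performance_opt_le1 _ J z) //=.
  by rewrite -Jz performance_le_opt.
have n0' : 0 < n%:R :> R by rewrite ltr0n.
have s0 : 0 < (size J)%:R :> R by rewrite ltr0n lt0n size_eq0; apply/eqP.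
rewrite opt divr1 /performance tot -/(served_weight R J (ALG J)).
case: swJ => [h|[-> h]]; last by rewrite ler_pM2r ?invr_gt0.
apply: (@le_trans _ _ 0); last by rewrite divr_ge0 // ltW.
by rewrite pmulr_lle0 ?invr_gt0.
Qed.

Lemma adversary (R : realType) (n : nat) (T : R) (ALG : algorithm R) :
  (3 <= n)%N -> 0 <= T -> T < 1 / (2 ^+ (n.-1) - 2) -> online ALG ->
  exists J, [/\ Defs.family n T J, J <> [::] &
    performance J (ALG J) / performance_opt J <= 1 / n%:R].
Proof.
case: n => [|[|[|m]]] // _ T0 T1 onl.
(* The first request goes to the end away from the vehicle, whose position at time 1 without any
   release is known. *)
pose eps : R := if ALG [::] 1 <= 0 then 1 else -1.
have eps1 : eps = 1 \/ eps = -1 by rewrite /eps; case: ifP; auto.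
have epsx : eps * ALG [::] 1 <= 0.
  by rewrite /eps; case: (leP (ALG [::] 1) 0) => h; lra.
have p0 : 1 <= 2 ^+ m :> R by apply: exprn_ege1; lra.
have [||J hJ] := adversary_start R T eps ALG T0 eps1 onl m.+1 _ _ epsx.
(* The starting condition is [lead (n - 1) < 1], which is the bound on T. *)
- rewrite addrC -[X in X < _]/(lead R T m.+2) leadE.
  move: T1; rewrite /= ltr_pdivlMr ?mul1r 1?mulrC //.
  by rewrite !exprS; lra.
- by rewrite /= -[leLHS]mul1r ler_wpM2r.
- exists J; split; [|by case: hJ|exact: (hard_ratio R T eps)].
  by case: hJ => -[].
Qed.

Theorem theorem4 (R : realType) (n : nat) (T : R)
    (hn : (3 <= n)%N) (hT0 : 0 <= T) (hT1 : T < 1 / (2 ^+ (n.-1) - 2)) :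
  (exists GR0 : algorithm R, is_GR0 GR0) /\
  (forall GR0 : algorithm R, is_GR0 GR0 -> optimal n T GR0) /\
  best_ratio n T = 1 / n%:R.
Proof.
have lb (ALG : algorithm R) : online ALG ->
    has_lbound [set performance I (ALG I) / performance_opt I |
        I in [set I | Defs.family n T I /\ I <> [::]]].
  move=> onl; exists 0 => _ [I [[iI _] I0] <-].
  apply: ratio_ge0 => //; first by case/andP: iI.
  by apply: onl.1; exact: instance_weaken iI.
have ub (ALG : algorithm R) : online ALG -> competitive_ratio n T ALG <= 1 / n%:R.
  move=> onl; have [J [fJ J0 le]] := adversary R n T ALG hn hT0 hT1 onl.
  by apply: le_trans le; apply: ge_inf; [exact: lb|exists J].
have GRE (GR0 : algorithm R) : is_GR0 GR0 -> competitive_ratio n T GR0 = 1 / n%:R.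
  move=> G; have onl := GR0_online R GR0 G.
  (* The adversary's instance also shows that the set of ratios is nonempty, as a lower bound on its
     [inf] requires. *)
  apply/eqP; rewrite eq_le ub //=; apply: lb_le_inf.
    have [J [fJ J0 _]] := adversary R n T GR0 hn hT0 hT1 onl.
    by exists (performance J (GR0 J) / performance_opt J), J.
  move=> _ [I [[iI In] I0] <-].
  have [xT xG] := G I (instance_weaken R T I hT0 iI).
  by apply: greedy_ratio => //; case/andP: iI.
have [GR0 G] := GR0_exists R.
have best : best_ratio n T = 1 / n%:R.
  apply/eqP; rewrite eq_le; apply/andP; split.
    apply: ge_sup; last by move=> _ [ALG onl <-]; exact: ub.
    by exists (competitive_ratio n T GR0), GR0 => //; exact: GR0_online.
  rewrite -(GRE GR0 G); apply: sup_upper_bound; last first.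
    by exists GR0 => //; exact: GR0_online.
  split; first by exists (competitive_ratio n T GR0), GR0 => //; exact: GR0_online.
  by exists (1 / n%:R) => _ [ALG onl <-]; exact: ub.
split; first by exists GR0.
split=> // GR1 G1; split; first exact: GR0_online.
by rewrite GRE.
Qed.
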